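(* Let $R$ be any (associative, not necessarily unital) ring. Then there are order-preserving maps $$\varphi\colon \mathrm{Lat}_{\mathrm{qp}}(R)\to\mathrm{Lat}_{\mathrm d}(R)\quad\text{and}\quad \psi\colon\mathrm{Lat}_{\mathrm d}(R)\to\mathrm{Lat}_{\mathrm{qp}}(R)$$ such that (i) $\psi\circ\varphi=\mathrm{id}$ and $\varphi\circ\psi\le\mathrm{id}$; (ii) $\varphi$ preserves suprema; (iii) $\psi$ preserves infima. In particular, as a partially ordered set, $\mathrm{Lat}_{\mathrm{qp}}(R)$ is a retract of $\mathrm{Lat}_{\mathrm d}(R)$.
   Context: $M_\infty(R)$ is the ring of infinite matrices over $R$ with finitely many nonzero entries. For $x,y\in M_\infty(R)$, $x\precsim_1 y$ means $x=syt$ for some $s,t\in M_\infty(R)$. A two-sided ideal $I$ of $R$ is decomposable if for every $x\in M_\infty(I)$ there is $y\in M_\infty(I)$ with $x\precsim_1 y$ in $M_\infty(R)$. It is quasipure if for every $x\in M_\infty(I)$ there are $s,y\in M_\infty(I)$ with $sy=y$ and $x\precsim_1 y$ in $M_\infty(R)$. $\mathrm{Lat}_{\mathrm d}(R)$ and $\mathrm{Lat}_{\mathrm{qp}}(R)$ are the sets of decomposable, respectively quasipure, two-sided ideals of $R$; ordered by inclusion, both are lattices. A partially ordered set $P$ is a retract of a partially ordered set $Q$ if there are order-preserving maps $P\to Q\to P$ composing to $\mathrm{id}_P$. *)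

(* Defs.v *)
From HB Require Import structures.
From mathcomp Require Import all_boot all_order all_algebra finmap.
From mathcomp Require Import boolp classical_sets.

Set Implicit Arguments.
Unset Strict Implicit.
Unset Printing Implicit Defensive.

Import Order.TTheory GRing.Theory.

Local Open Scope ring_scope.
Local Open Scope fset_scope.
Local Open Scope classical_set_scope.

(* Associative, not necessarily unital, rings; the ring structures of ssralg
   all have a unit element. *)
HB.mixin Record Zmodule_isRng R & GRing.Zmodule R := {
  rmul : R -> R -> R;
  rmulA : associative rmul;
  rmulDl : left_distributive rmul +%R;
  rmulDr : right_distributive rmul +%R
}.

#[short(type="rngType")]
HB.structure Definition Rng := {R of GRing.Zmodule R & Zmodule_isRng R}.

Lemma rmul0r (R : rngType) (x : R) : rmul 0 x = 0.
Proof. by apply: (@addIr _ (rmul 0 x)); rewrite -rmulDl !add0r. Qed.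

Lemma rmulr0 (R : rngType) (x : R) : rmul x 0 = 0.
Proof. by apply: (@addIr _ (rmul x 0)); rewrite -rmulDr !add0r. Qed.

(* The (i, j) entry of x : Minf R is x (i, j). *)
Definition Minf (R : rngType) := {fsfun nat * nat -> R with 0}.

(* A sum over k of x (i, k) * y (k, j) only involves the k that occur as column
   indices in the support of x, and it vanishes unless i is a row index in the
   support of x and j a column index in the support of y; see mulmE. *)
Definition mulm (R : rngType) (x y : Minf R) : Minf R :=
  [fsfun p in [fset (a.1, b.2) | a in finsupp x, b in finsupp y] =>
     \sum_(k <- [fset a.2 | a in finsupp x]) rmul (x (p.1, k)) (y (k, p.2))].

Lemma mulmE (R : rngType) (x y : Minf R) (n i j : nat) :
  (forall k, (n <= k)%N -> x (i, k) = 0) ->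
  mulm x y (i, j) = \sum_(k < n) rmul (x (i, val k)) (y (val k, j)).
Proof.
move=> xn.
pose S := [fset a.2 | a in finsupp x].
pose F k := rmul (x (i, k)) (y (k, j)).
have FS k : k \notin S -> F k = 0.
  move=> kS; rewrite /F fsfun_dflt ?rmul0r//; apply: contra kS => xk.
  by apply/imfsetP; exists (i, k).
have -> : \sum_(k < n) F k = \sum_(k <- S) F k.
  transitivity (\sum_(0 <= k < n | k \in S) F k).
    by rewrite big_mkord [RHS]big_mkcond; apply: eq_bigr => k _; case: ifPn => // /FS.
  transitivity (\sum_(k <- S | (k < n)%N) F k).
    rewrite -big_filter -[RHS]big_filter; apply: perm_big.
    apply: uniq_perm; rewrite ?filter_uniq ?iota_uniq ?fset_uniq// => k.
    by rewrite !mem_filter mem_index_iota /= andbC.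
  rewrite big_mkcond; apply: eq_bigr => k _; case: ltnP => // /xn xk.
  by rewrite /F xk rmul0r.
rewrite /mulm fsfunE; case: ifPn => // ij.
rewrite big1 // => k _; have [xk|xk] := boolP ((i, k) \in finsupp x); last first.
  by rewrite /F fsfun_dflt ?rmul0r.
have [yk|yk] := boolP ((k, j) \in finsupp y); last first.
  by rewrite /F [X in rmul _ X]fsfun_dflt ?rmulr0.
by case/negP: ij; apply/imfset2P; exists (i, k) => //; exists (k, j).
Qed.

Definition precsim1 (R : rngType) (x y : Minf R) : Prop :=
  exists s t : Minf R, x = mulm (mulm s y) t.

Definition two_sided_ideal (R : rngType) (I : set R) : Prop :=
  [/\ I 0,
      forall x y, I x -> I y -> I (x - y) &
      forall r x, I x -> I (rmul r x) /\ I (rmul x r)].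

Definition Minf_of (R : rngType) (I : set R) : set (Minf R) :=
  [set x | forall p, I (x p)].

Definition decomposable (R : rngType) (I : set R) : Prop :=
  forall x, Minf_of I x -> exists2 y, Minf_of I y & precsim1 x y.

Definition quasipure (R : rngType) (I : set R) : Prop :=
  forall x, Minf_of I x ->
    exists s y, [/\ Minf_of I s, Minf_of I y, mulm s y = y & precsim1 x y].

Definition Latd (R : rngType) :=
  set_type [set I : set R | two_sided_ideal I /\ decomposable I].

Definition Latqp (R : rngType) :=
  set_type [set I : set R | two_sided_ideal I /\ quasipure I].

HB.instance Definition _ (R : rngType) := SubChoice.on (Latd R).
HB.instance Definition _ (R : rngType) := SubChoice.on (Latqp R).

(* The order on set R is inclusion. *)
HB.instance Definition _ (R : rngType) :=
  [SubChoice_isSubPOrder of Latd R by <: with set_display].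
HB.instance Definition _ (R : rngType) :=
  [SubChoice_isSubPOrder of Latqp R by <: with set_display].

Lemma le_LatdE (R : rngType) (I J : Latd R) :
  (I <= J)%O = (val I `<=` val J) :> Prop.
Proof. by apply/propext; rewrite -Order.le_val subsetEset. Qed.

Lemma le_LatqpE (R : rngType) (I J : Latqp R) :
  (I <= J)%O = (val I `<=` val J) :> Prop.
Proof. by apply/propext; rewrite -Order.le_val subsetEset. Qed.

(* Suprema and infima of arbitrary families. *)
Definition preserves_suprema d d' (P : porderType d) (Q : porderType d')
    (f : P -> Q) : Prop :=
  forall (A : set P) (a : P), supremums A a -> supremums (f @` A) (f a).

Definition preserves_infima d d' (P : porderType d) (Q : porderType d')
    (f : P -> Q) : Prop :=
  forall (A : set P) (a : P), infimums A a -> infimums (f @` A) (f a).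

Definition is_retract d d' (P : porderType d) (Q : porderType d') : Prop :=
  exists (f : P -> Q) (g : Q -> P),
    [/\ Order.nondecreasing f, Order.nondecreasing g & g \o f = id].

(* Main.v *)
Require Import Defs.
From HB Require Import structures.
From mathcomp Require Import all_boot all_order all_algebra finmap.
From mathcomp Require Import boolp classical_sets.

(** A quasipure ideal is decomposable: the matrix [y] of the definition already
    has its entries in the ideal. So [phi] can be the inclusion, and the
    natural candidate for [psi] sends an ideal [I] to the largest quasipure
    ideal contained in [I]. Once that ideal is known to exist, [phi] and [psi]
    form a Galois connection with [psi \o phi = id], and adjunction gives
    everything else: left adjoints preserve suprema, right adjoints preserve
    infima ([left_adjoint_preserves_suprema],
    [right_adjoint_preserves_infima]).

    The largest quasipure ideal exists because quasipure ideals are closed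
    under binary sums ([quasipure_add]) and directed unions. For a sum [I + J],
    a matrix [x] over [I + J] splits as [x1 + x2] with [x1] over [I] and [x2]
    over [J]. If [s1 y1 = y1], [s2 y2 = y2] and [xi] is below [yi],
    then [diag(s1, s2)] fixes [diag(y1, y2)] and [x] is below [diag(y1, y2)]
    ([mulm_diag_block], [precsim1_add]).
    For a directed union, the finitely many nonzero entries of a matrix all lie
    in one member of the family ([qpart_directed], [quasipure_qpart]). *)

Set Implicit Arguments.
Unset Strict Implicit.
Unset Printing Implicit Defensive.

Import Order.TTheory GRing.Theory.

Local Open Scope fset_scope.
Local Open Scope ring_scope.
Local Open Scope classical_set_scope.

(** * Block matrices *)

Section BlockMatrices.
Context {R : rngType}.
Implicit Types x y z a b c d : Minf R.

Lemma Minf_bounded x :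
  exists n, forall i j, (n <= i)%N || (n <= j)%N -> x (i, j) = 0.
Proof.
exists (\max_(p <- finsupp x) (maxn p.1 p.2).+1)%N => i j nij.
apply: fsfun_dflt; apply/negP => xij; move: nij.
have /= le_max := @leq_bigmax_seq _ _ xpredT
  (fun p : nat * nat => (maxn p.1 p.2).+1) _ xij isT.
rewrite leqNgt [X in _ || X]leqNgt -negb_and => /negP; apply.
apply/andP; split; apply: leq_trans le_max; rewrite ltnS ?leq_maxl//.
exact: leq_maxr.
Qed.

(** All indices range over [nat], so two blocks cannot be put after each
    other; they are interleaved instead, the first one on even indices and the
    second one on odd indices. *)
Definition row_block x y : Minf R :=
  [fsfun p in ([fset (a.1, a.2.*2) | a in finsupp x]
      `|` [fset (a.1, a.2.*2.+1) | a in finsupp y])%fset =>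
    if odd p.2 then y (p.1, p.2./2) else x (p.1, p.2./2)].

Definition col_block x y : Minf R :=
  [fsfun p in ([fset (a.1.*2, a.2) | a in finsupp x]
      `|` [fset (a.1.*2.+1, a.2) | a in finsupp y])%fset =>
    if odd p.1 then y (p.1./2, p.2) else x (p.1./2, p.2)].

Definition zerom : Minf R := [fsfun].

Definition diag_block x y : Minf R :=
  col_block (row_block x zerom) (row_block zerom y).

Lemma zeromE p : zerom p = 0.
Proof. by rewrite fsfun0E. Qed.

Lemma row_blockE x y i j :
  row_block x y (i, j) = if odd j then y (i, j./2) else x (i, j./2).
Proof.
rewrite fsfunE; case: ifPn => //= ij; apply/esym.
have jE := odd_double_half j.
case: ifPn ij jE => /= oj ij jE; apply: fsfun_dflt; apply: contra ij => ij.
  by rewrite inE; apply/orP; right; apply/imfsetP; exists (i, j./2);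
    rewrite //= -[in LHS]jE.
by rewrite inE; apply/orP; left; apply/imfsetP; exists (i, j./2);
  rewrite //= -[in LHS]jE.
Qed.

Lemma col_blockE x y i j :
  col_block x y (i, j) = if odd i then y (i./2, j) else x (i./2, j).
Proof.
rewrite fsfunE; case: ifPn => //= ij; apply/esym.
have iE := odd_double_half i.
case: ifPn ij iE => /= oi ij iE; apply: fsfun_dflt; apply: contra ij => ij.
  by rewrite inE; apply/orP; right; apply/imfsetP; exists (i./2, j);
    rewrite //= -[in LHS]iE.
by rewrite inE; apply/orP; left; apply/imfsetP; exists (i./2, j);
  rewrite //= -[in LHS]iE.
Qed.

Lemma sum_even_odd (F : nat -> R) n :
  \sum_(k < n.*2) F k = \sum_(k < n) F k.*2 + \sum_(k < n) F k.*2.+1.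
Proof.
elim: n => [|n IHn]; first by rewrite !big_ord0 addr0.
by rewrite doubleS !big_ord_recr /= IHn -!addrA; congr (_ + _);
  rewrite addrCA.
Qed.

Lemma mulm_col_block a b c :
  mulm (col_block a b) c = col_block (mulm a c) (mulm b c).
Proof.
apply/fsfunP => -[i j].
have [n an] := Minf_bounded a; have [m bm] := Minf_bounded b.
have a0 i' k : (maxn n m <= k)%N -> a (i', k) = 0.
  by rewrite geq_max => /andP[nk _]; apply: an; rewrite nk orbT.
have b0 i' k : (maxn n m <= k)%N -> b (i', k) = 0.
  by rewrite geq_max => /andP[_ mk]; apply: bm; rewrite mk orbT.
rewrite col_blockE (@mulmE _ _ _ (maxn n m)); last first.
  by move=> k nk; rewrite col_blockE a0// b0// if_same.
case: ifPn => oi; rewrite (@mulmE _ _ _ (maxn n m));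
  do ?[by move=> k; exact: a0 | by move=> k; exact: b0];
  by apply: eq_bigr => k _; rewrite col_blockE ?oi ?(negbTE oi).
Qed.

Lemma mulm_row_block a b c :
  mulm a (row_block b c) = row_block (mulm a b) (mulm a c).
Proof.
apply/fsfunP => -[i j].
have [n an] := Minf_bounded a.
have a0 k : (n <= k)%N -> a (i, k) = 0 by move=> nk; apply: an; rewrite nk orbT.
rewrite row_blockE !(@mulmE _ _ _ n)//.
by case: ifPn => oj; apply: eq_bigr => k _; rewrite row_blockE ?oj ?(negbTE oj).
Qed.

Lemma mulm_row_col_block a b c d p :
  mulm (row_block a b) (col_block c d) p = mulm a c p + mulm b d p.
Proof.
case: p => i j.
have [n an] := Minf_bounded a; have [m bm] := Minf_bounded b.
have a0 k : (maxn n m <= k)%N -> a (i, k) = 0.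
  by rewrite geq_max => /andP[nk _]; apply: an; rewrite nk orbT.
have b0 k : (maxn n m <= k)%N -> b (i, k) = 0.
  by rewrite geq_max => /andP[_ mk]; apply: bm; rewrite mk orbT.
rewrite (@mulmE _ _ _ (maxn n m).*2); last first.
  move=> k nk; have {}nk : (maxn n m <= k./2)%N by rewrite geq_half_double.
  by rewrite row_blockE a0// b0// if_same.
rewrite (@mulmE _ a _ (maxn n m))// (@mulmE _ b _ (maxn n m))//.
rewrite (sum_even_odd
  (fun k => rmul (row_block a b (i, k)) (col_block c d (k, j)))).
by congr (_ + _); apply: eq_bigr => k _;
  rewrite row_blockE col_blockE /= odd_double /= ?uphalf_double ?doubleK.
Qed.

Lemma mulm0 a : mulm a zerom = zerom.
Proof.
apply/fsfunP => -[i j]; have [n an] := Minf_bounded a.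
rewrite (@mulmE _ _ _ n) => [|k nk]; last by apply: an; rewrite nk orbT.
by rewrite zeromE big1// => k _; rewrite zeromE rmulr0.
Qed.

Lemma mulm_row_diag_block a b y z :
  mulm (row_block a b) (diag_block y z) = row_block (mulm a y) (mulm b z).
Proof.
apply/fsfunP => -[i j]; rewrite mulm_row_col_block !mulm_row_block !mulm0.
by rewrite !row_blockE !zeromE; case: ifP => _; rewrite ?addr0 ?add0r.
Qed.

Lemma mul0m a : mulm zerom a = zerom.
Proof.
apply/fsfunP => -[i j]; rewrite (@mulmE _ _ _ 0) => [|k _]; last exact: zeromE.
by rewrite big_ord0 zeromE.
Qed.

Lemma mulm_diag_block a b y z :
  mulm (diag_block a b) (diag_block y z) = diag_block (mulm a y) (mulm b z).
Proof. by rewrite mulm_col_block !mulm_row_diag_block !mul0m. Qed.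

Lemma Minf_of_diag_block (I : set R) y z :
  I 0 -> Minf_of I y -> Minf_of I z -> Minf_of I (diag_block y z).
Proof.
move=> I0 Iy Iz [i j]; rewrite /= col_blockE !row_blockE !zeromE.
by do 2!case: ifP => _.
Qed.

(** If [xi = ui yi ti], then [x1 + x2] is the product of the row [(u1 u2)], the
    block diagonal matrix and the column with blocks [t1] and [t2]. *)
Lemma precsim1_add x x1 x2 y1 y2 :
  (forall p, x p = x1 p + x2 p) ->
  precsim1 x1 y1 -> precsim1 x2 y2 -> precsim1 x (diag_block y1 y2).
Proof.
move=> xE [u1 [t1 x1E]] [u2 [t2 x2E]].
exists (row_block u1 u2), (col_block t1 t2); apply/fsfunP => p.
by rewrite mulm_row_diag_block mulm_row_col_block -x1E -x2E.
Qed.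

End BlockMatrices.

(** * Sums and directed unions of quasipure ideals *)

Section QuasipureIdeals.
Context {R : rngType}.
Implicit Types I J K : set R.

Lemma quasipure_decomposable I : quasipure I -> decomposable I.
Proof. by move=> qI x /qI[s [y [_ Iy _ xy]]]; exists y. Qed.

Lemma ideal_add_closed I : two_sided_ideal I ->
  forall x y, I x -> I y -> I (x + y).
Proof.
move=> [I0 IB _] x y Ix Iy; rewrite -[y]opprK; apply: (IB) => //.
by rewrite -sub0r; apply: IB.
Qed.

Definition ideal_add I J : set R := [set a + b | a in I & b in J].

Lemma sub_ideal_addl I J : J 0 -> I `<=` ideal_add I J.
Proof. by move=> J0 a Ia; exists a => //; exists 0 => //; rewrite addr0. Qed.

Lemma sub_ideal_addr I J : I 0 -> J `<=` ideal_add I J.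
Proof. by move=> I0 a Ja; exists 0 => //; exists a => //; rewrite add0r. Qed.

Lemma two_sided_ideal_add I J :
  two_sided_ideal I -> two_sided_ideal J -> two_sided_ideal (ideal_add I J).
Proof.
move=> [I0 IB IM] [J0 JB JM]; split.
- exact: sub_ideal_addl.
- move=> _ _ [a Ia [b Jb <-]] [c Ic [d Jd <-]].
  exists (a - c); [exact: IB | exists (b - d); first exact: JB].
  by rewrite opprD addrACA.
- move=> r _ [a Ia [b Jb <-]].
  have [Ira Iar] := IM r a Ia; have [Jrb Jbr] := JM r b Jb; split.
    by exists (rmul r a) => //; exists (rmul r b); rewrite ?rmulDr.
  by exists (rmul a r) => //; exists (rmul b r); rewrite ?rmulDl.
Qed.

Lemma Minf_of_ideal_addP I J (x : Minf R) : Minf_of (ideal_add I J) x ->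
  I 0 -> J 0 ->
  exists x1 x2 : Minf R,
    [/\ Minf_of I x1, Minf_of J x2 & forall p, x p = x1 p + x2 p].
Proof.
move=> IJx I0 J0.
have /choice[b bE] p : exists c : R * R, [/\ I c.1, J c.2 & x p = c.1 + c.2].
  by have [c Ic [d Jd <-]] := IJx p; exists (c, d).
exists [fsfun p in finsupp x => (b p).1], [fsfun p in finsupp x => (b p).2].
split=> p; rewrite ?fsfunE; have [Ib Jb xE] := bE p.
- by case: ifP.
- by case: ifP.
- by case: ifPn => [_|/fsfun_dflt ->]; rewrite ?addr0.
Qed.

Lemma quasipure_add I J : two_sided_ideal I -> two_sided_ideal J ->
  quasipure I -> quasipure J -> quasipure (ideal_add I J).
Proof.
move=> idI idJ qI qJ x IJx.
have [IJ0 _ _] := two_sided_ideal_add idI idJ.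
case: idI idJ => I0 _ _ [J0 _ _].
have [x1 [x2 [Ix1 Jx2 xE]]] := Minf_of_ideal_addP IJx I0 J0.
have [s1 [y1 [Is1 Iy1 sy1 xy1]]] := qI _ Ix1.
have [s2 [y2 [Js2 Jy2 sy2 xy2]]] := qJ _ Jx2.
have subI (z : Minf R) : Minf_of I z -> Minf_of (ideal_add I J) z.
  by move=> Iz p; apply: sub_ideal_addl => //; exact: Iz.
have subJ (z : Minf R) : Minf_of J z -> Minf_of (ideal_add I J) z.
  by move=> Jz p; apply: sub_ideal_addr => //; exact: Jz.
exists (diag_block s1 s2), (diag_block y1 y2); split.
- by apply: Minf_of_diag_block => //; [exact: subI | exact: subJ].
- by apply: Minf_of_diag_block => //; [exact: subI | exact: subJ].
- by rewrite mulm_diag_block sy1 sy2.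
- exact: precsim1_add xy1 xy2.
Qed.

Lemma two_sided_ideal0 : two_sided_ideal [set 0 : R].
Proof.
split=> // [_ _ -> ->|r _ ->]; first by rewrite /= subr0.
by rewrite /= rmul0r rmulr0.
Qed.

Lemma quasipure0 : quasipure [set 0 : R].
Proof.
move=> x x0; have -> : x = zerom by apply/fsfunP => p; rewrite zeromE; exact: x0.
exists zerom, zerom; split=> [p|p||]; rewrite /= ?zeromE ?mulm0//.
by exists zerom, zerom; rewrite !mulm0.
Qed.

(** The largest quasipure ideal below [I]. The union of the quasipure ideals
    below [I] needs no closure under sums, since it is directed. *)
Definition qpart I : set R :=
  [set a | exists K, [/\ two_sided_ideal K, quasipure K, K `<=` I & K a]].

Lemma qpart_sub I : qpart I `<=` I.
Proof. by move=> a [K [_ _ KI Ka]]; exact: KI. Qed.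

Lemma sub_qpart I K :
  two_sided_ideal K -> quasipure K -> K `<=` I -> K `<=` qpart I.
Proof. by move=> idK qK KI a Ka; exists K. Qed.

(** Directedness: finitely many elements of [qpart I] lie in one quasipure
    ideal below [I]. *)
Lemma qpart_directed I (s : seq R) : two_sided_ideal I ->
  (forall a, a \in s -> qpart I a) ->
  exists K, [/\ two_sided_ideal K, quasipure K, K `<=` I &
    forall a, a \in s -> K a].
Proof.
move=> idI; elim: s => [_|a s IHs sI].
  exists [set 0]; split=> //; [exact: two_sided_ideal0|exact: quasipure0|].
  by move=> _ ->; case: idI.
have [K [idK qK KI Ks]] : exists K, [/\ two_sided_ideal K, quasipure K,
    K `<=` I & forall b, b \in s -> K b].
  by apply: IHs => b bs; apply: sI; rewrite inE bs orbT.
have [J [idJ qJ JI Ja]] : qpart I a by apply: sI; rewrite mem_head.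
exists (ideal_add J K); split.
- exact: two_sided_ideal_add.
- exact: quasipure_add.
- by move=> _ [b /JI Ib [c /KI Ic <-]]; apply: ideal_add_closed.
- move=> b; rewrite inE => /predU1P[->|/Ks Kb].
    by apply: sub_ideal_addl => //; case: idK.
  by apply: sub_ideal_addr => //; case: idJ.
Qed.

Lemma two_sided_ideal_qpart I : two_sided_ideal I -> two_sided_ideal (qpart I).
Proof.
move=> idI; split.
- have [K [idK qK KI _]] : exists K, [/\ two_sided_ideal K, quasipure K,
      K `<=` I & forall a, a \in [::] -> K a] by exact: qpart_directed.
  by exists K; split=> //; case: idK.
- move=> a b Ia Ib.
  have [c|K [idK qK KI Kab]] := @qpart_directed I [:: a; b] idI.
    by rewrite !inE => /orP[]/eqP ->.
  exists K; split=> //; case: idK => _ KB _.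
  by apply: KB; apply: Kab; rewrite !inE eqxx ?orbT.
- move=> r a [K [idK qK KI Ka]].
  have [_ _ /(_ r a Ka)[Kra Kar]] := idK.
  by split; exists K.
Qed.

Lemma quasipure_qpart I : two_sided_ideal I -> quasipure (qpart I).
Proof.
move=> idI x Ix.
have [a|K [idK qK KI Kx]] := @qpart_directed I [seq x p | p <- finsupp x] idI.
  by case/mapP => p _ ->; exact: Ix.
have {}Kx : Minf_of K x.
  move=> p; have [px|px] := boolP (p \in finsupp x).
    by apply: Kx; exact: map_f.
  by rewrite /= fsfun_dflt//; case: idK.
have [s [y [Ks Ky sy xy]]] := qK _ Kx.
by exists s, y; split=> // p; apply: (sub_qpart idK qK KI);
  [exact: Ks | exact: Ky].
Qed.

End QuasipureIdeals.

(** * Galois connections *)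

Section GaloisConnection.
Context {d d' : Order.disp_t} {P : porderType d} {Q : porderType d'}.
Variables (f : P -> Q) (g : Q -> P).
Hypothesis adj : forall x y, (f x <= y)%O = (x <= g y)%O.

Lemma left_adjoint_nondecreasing : Order.nondecreasing f.
Proof. by move=> x y xy; rewrite adj; apply: le_trans xy _; rewrite -adj. Qed.

Lemma right_adjoint_nondecreasing : Order.nondecreasing g.
Proof. by move=> x y xy; rewrite -adj; apply: le_trans xy; rewrite adj. Qed.

Lemma left_adjoint_preserves_suprema : preserves_suprema f.
Proof.
move=> A a [Aa a_min]; split=> [_ [x Ax <-]|y Ay].
  by apply: left_adjoint_nondecreasing; exact: Aa.
by rewrite adj; apply: a_min => x Ax; rewrite -adj; apply: Ay; exists x.
Qed.

Lemma right_adjoint_preserves_infima : preserves_infima g.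
Proof.
move=> A a [Aa a_max]; split=> [_ [x Ax <-]|y Ay].
  by apply: right_adjoint_nondecreasing; exact: Aa.
by rewrite -adj; apply: a_max => x Ax; rewrite adj; apply: Ay; exists x.
Qed.

End GaloisConnection.

(** * The adjunction between quasipure and decomposable ideals *)

Section Lattices.
Context {R : rngType}.

Lemma Latqp_decomposable (I : Latqp R) :
  [set I : set R | two_sided_ideal I /\ decomposable I] (val I).
Proof.
by have [idI qI] := set_valP I; split=> //; exact: quasipure_decomposable.
Qed.

Lemma Latd_qpart (I : Latd R) :
  [set I : set R | two_sided_ideal I /\ quasipure I] (qpart (val I)).
Proof.
have [idI _] := set_valP I.
by split; [exact: two_sided_ideal_qpart | exact: quasipure_qpart].
Qed.

Definition Latd_of_Latqp (I : Latqp R) : Latd R :=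
  exist _ (val I) (mem_set (Latqp_decomposable I)).

Definition Latqp_of_Latd (I : Latd R) : Latqp R :=
  exist _ (qpart (val I)) (mem_set (Latd_qpart I)).

Lemma Latqp_Latd_adjoint (I : Latqp R) (J : Latd R) :
  (Latd_of_Latqp I <= J)%O = (I <= Latqp_of_Latd J)%O.
Proof.
have [idI qI] := set_valP I.
apply/idP/idP; rewrite le_LatdE le_LatqpE /= => IJ.
  exact: sub_qpart.
exact: subset_trans IJ (@qpart_sub _ _).
Qed.

Lemma Latd_of_LatqpK : Latqp_of_Latd \o Latd_of_Latqp = id.
Proof.
apply/funext => I; apply: val_inj => /=; have [idI qI] := set_valP I.
by apply/seteqP; split; [exact: qpart_sub | exact: sub_qpart].
Qed.

End Lattices.

Theorem theorem4p12 (R : rngType) :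
  (exists (phi : Latqp R -> Latd R) (psi : Latd R -> Latqp R),
     [/\ Order.nondecreasing phi /\ Order.nondecreasing psi,
         psi \o phi = id /\ (forall I : Latd R, (phi (psi I) <= I)%O),
         preserves_suprema phi &
         preserves_infima psi])
  /\ is_retract (Latqp R) (Latd R).
Proof.
have adj := @Latqp_Latd_adjoint R.
have phi_mono := left_adjoint_nondecreasing adj.
have psi_mono := right_adjoint_nondecreasing adj.
split; last first.
  by exists Latd_of_Latqp, Latqp_of_Latd; split=> //; exact: Latd_of_LatqpK.
exists Latd_of_Latqp, Latqp_of_Latd; split=> //.
- by split=> [|I]; [exact: Latd_of_LatqpK | rewrite adj].
- exact: left_adjoint_preserves_suprema adj.
- exact: right_adjoint_preserves_infima adj.
Qed.
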